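(* Let $\mathcal{H}$ be a separable Hilbert space, let $\{f_i\}_{i\in I}$ and $\{g_i\}_{i\in I}$ be Bessel sequences in $\mathcal{H}$ with analysis operators $T_1$ and $T_2$, respectively, and let $L_1,L_2:\mathcal{H}\to\mathcal{H}$ be bounded linear operators. Then the following are equivalent: (1) $\{L_1f_i+L_2g_i\}_{i\in I}$ is a Riesz basis for $\mathcal{H}$; (2) $T_1L_1^*+T_2L_2^*$ is an invertible operator from $\mathcal{H}$ onto $\ell^2(I)$.
   Context: The index set $I$ is countable. A sequence $\{f_i\}_{i\in I}\subseteq\mathcal{H}$ is a Bessel sequence if there is $B<\infty$ with $\sum_{i\in I}|\langle f,f_i\rangle|^2\leqslant B\|f\|^2$ for all $f\in\mathcal{H}$. The analysis operator of a Bessel sequence $\{f_i\}_{i\in I}$ is the bounded operator $T:\mathcal{H}\to\ell^2(I)$, $Tf=\{\langle f,f_i\rangle\}_{i\in I}$. A sequence $\{f_i\}_{i\in I}$ is a Riesz basis for $\mathcal{H}$ if its closed linear span is $\mathcal{H}$ and there exist $0<A\leqslant B<\infty$ with $A\sum_i|c_i|^2\leqslant\|\sum_i c_if_i\|^2\leqslant B\sum_i|c_i|^2$ for all finitely supported scalar families $(c_i)_{i\in I}$. An operator is invertible if it is a bijective bounded operator with bounded inverse. *)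

(* Defs.v *)
From HB Require Import structures.
From mathcomp Require Import all_boot all_order all_algebra.
From mathcomp Require Import complex finmap ring.
From mathcomp Require Import all_classical all_reals all_analysis.

Set Implicit Arguments.
Unset Strict Implicit.
Unset Printing Implicit Defensive.

Import Order.TTheory GRing.Theory Num.Theory.
Import numFieldNormedType.Exports.

Local Open Scope classical_set_scope.
Local Open Scope ring_scope.

(* Scalars are R or R[i]: every definition below covers real and complex      *)
(* Hilbert spaces uniformly.                                                  *)
Inductive scalar_kind := RealScalars | ComplexScalars.

Definition scalarField (R : realType) (k : scalar_kind) : numFieldType :=
  match k with RealScalars => R | ComplexScalars => R[i] end.

Definition sconj (R : realType) (k : scalar_kind) :
    scalarField R k -> scalarField R k :=
  match k with
  | RealScalars => idfun
  | ComplexScalars => @Num.conj R[i]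
  end.

Definition of_real (R : realType) (k : scalar_kind) : R -> scalarField R k :=
  match k with
  | RealScalars => idfun
  | ComplexScalars => real_complex R
  end.

Definition re (R : realType) (k : scalar_kind) : scalarField R k -> R :=
  match k with
  | RealScalars => idfun
  | ComplexScalars => @complex.Re R
  end.

Arguments sconj {R k}.
Arguments of_real {R k}.
Arguments re {R k}.

(* In a normed module over `scalarField R k` the norm `|x| is an element of   *)
(* `scalarField R k`; `rnorm x` is the same number in R (see `of_real_rnorm`).*)
Definition rnorm (R : realType) (k : scalar_kind)
  (V : normedZmodType (scalarField R k)) (x : V) : R := re `|x|.

Section ScalarTheory.
Variables (R : realType) (k : scalar_kind).
Implicit Types x y : scalarField R k.

Lemma rnorm_ge0 (V : normedZmodType (scalarField R k)) (v : V) : 0 <= rnorm v.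
Proof.
have := normr_ge0 v; rewrite /rnorm; move: `|v|; clear.
by case: k => //= x; rewrite lecE => /andP[].
Qed.

Lemma of_real_rnorm (V : normedZmodType (scalarField R k)) (v : V) :
  of_real (rnorm v) = `|v|.
Proof.
have := normr_ge0 v; rewrite /rnorm; move: `|v|; clear.
by case: k => //= x /ger0_real/RRe_real.
Qed.

Lemma of_real_ge0 (r : R) : (0 <= of_real r :> scalarField R k) = (0 <= r).
Proof. by case: k => //=; exact: ler0c. Qed.

Lemma ler_of_real (r s : R) :
  (of_real r <= of_real s :> scalarField R k) = (r <= s).
Proof. by case: k => //=; exact: lecR. Qed.

Lemma of_realD (r s : R) : of_real (r + s) = of_real r + of_real s :> scalarField R k.
Proof. by case: k => //=; exact: rmorphD. Qed.

Lemma of_realM (r s : R) : of_real (r * s) = of_real r * of_real s :> scalarField R k.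
Proof. by case: k => //=; exact: rmorphM. Qed.

Lemma of_real0 : of_real 0 = 0 :> scalarField R k.
Proof. by case: k. Qed.

Lemma of_real_inj : injective (@of_real R k).
Proof. by case: k => //=; exact: complexI. Qed.

Lemma rnormD (V : normedZmodType (scalarField R k)) (u v : V) :
  rnorm (u + v) <= rnorm u + rnorm v.
Proof. by rewrite -ler_of_real of_realD !of_real_rnorm ler_normD. Qed.

Lemma rnormM x y : rnorm (x * y) = rnorm x * rnorm y.
Proof. by apply: of_real_inj; rewrite of_realM !of_real_rnorm normrM. Qed.

Lemma rnorm0 (V : normedZmodType (scalarField R k)) : rnorm (0 : V) = 0.
Proof. by apply: of_real_inj; rewrite of_real_rnorm normr0 of_real0. Qed.

Lemma rnorm0_eq0 (V : normedZmodType (scalarField R k)) (v : V) :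
  rnorm v = 0 -> v = 0.
Proof.
by move=> v0; apply: normr0_eq0; rewrite -of_real_rnorm v0 of_real0.
Qed.

End ScalarTheory.

Section SquareSummable.
Variables (R : realType) (k : scalar_kind) (I : countType).
Implicit Types a b : I -> scalarField R k.

Definition sqsum a : \bar R := (\esum_(i in [set: I]) ((rnorm (a i)) ^+ 2)%:E)%E.

Lemma sqsum_ge0 a : (0 <= sqsum a)%E.
Proof. by apply: esum_ge0 => i _; rewrite lee_fin sqr_ge0. Qed.

Lemma sqsum_leP a (r : R) : (sqsum a <= r%:E)%E <->
  forall F : {fset I}, \sum_(i <- F) (rnorm (a i)) ^+ 2 <= r.
Proof.
split=> [h F|h].
- rewrite -lee_fin -sumEFin; apply: le_trans h; apply: esum_ge.
  have finF : finite_set [set` F] by exact: finite_fset.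
  exists [set` F] => //.
  by rewrite (fsbig_finite _ _ finF)/= set_fsetK.
- apply: ge_ereal_sup => _ [A [finA _] <-].
  by rewrite fsbig_finite//= sumEFin lee_fin h.
Qed.

Definition sqsummable : {pred I -> scalarField R k} := fun a => `[< (sqsum a < +oo)%E >].

Lemma sqsummableP a : reflect (sqsum a < +oo)%E (a \in sqsummable).
Proof. exact: asboolP. Qed.

Lemma sqsummable_fin a : a \in sqsummable -> sqsum a = (fine (sqsum a))%:E.
Proof. by move/sqsummableP => h; rewrite fineK// ge0_fin_numE ?sqsum_ge0. Qed.

Definition sqnorm a : R := Num.sqrt (fine (sqsum a)).

Lemma sqr_sqnorm a : sqnorm a ^+ 2 = fine (sqsum a).
Proof. by rewrite sqr_sqrtr// fine_ge0// sqsum_ge0. Qed.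

Lemma sqnorm_leP a (r : R) : 0 <= r ->
  (a \in sqsummable /\ sqnorm a <= r) <->
  forall F : {fset I}, \sum_(i <- F) (rnorm (a i)) ^+ 2 <= r ^+ 2.
Proof.
move=> r0; rewrite -sqsum_leP; split=> [[sa ar]|h].
  rewrite (sqsummable_fin sa) lee_fin -sqr_sqnorm.
  by rewrite ler_sqr ?nnegrE ?sqrtr_ge0.
have sa : a \in sqsummable.
  by apply/sqsummableP; apply: le_lt_trans h _; rewrite ltry.
split=> //; rewrite -ler_sqr ?nnegrE ?sqrtr_ge0// sqr_sqnorm.
by rewrite -lee_fin -sqsummable_fin.
Qed.

Lemma sqnorm_sum a (F : {fset I}) : a \in sqsummable ->
  \sum_(i <- F) (rnorm (a i)) ^+ 2 <= sqnorm a ^+ 2.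
Proof. by move=> sa; apply/(sqnorm_leP a (sqrtr_ge0 _)): F; split. Qed.

Lemma sqnorm_eq0 a : a \in sqsummable -> sqnorm a = 0 -> a = 0.
Proof.
move=> sa a0; apply/funext => i; apply: rnorm0_eq0; apply/eqP.
rewrite -sqrf_eq0 eq_le sqr_ge0 andbT.
by have := sqnorm_sum [fset i]%fset sa; rewrite big_seq_fset1 a0 expr0n.
Qed.

Lemma sqnormD a b : a \in sqsummable -> b \in sqsummable ->
  a + b \in sqsummable /\ sqnorm (a + b) <= sqnorm a + sqnorm b.
Proof.
move=> sa sb; have A0 := sqrtr_ge0 (fine (sqsum a)).
have B0 := sqrtr_ge0 (fine (sqsum b)).
rewrite -!/(sqnorm _) in A0 B0.
have [A_eq0|A_neq0] := eqVneq (sqnorm a) 0.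
  by rewrite (sqnorm_eq0 sa A_eq0) !add0r; split=> //; rewrite lerDr sqrtr_ge0.
have [B_eq0|B_neq0] := eqVneq (sqnorm b) 0.
  by rewrite (sqnorm_eq0 sb B_eq0) !addr0; split=> //; rewrite lerDl sqrtr_ge0.
have {A0 A_neq0}A0 : 0 < sqnorm a by rewrite lt_neqAle eq_sym A_neq0.
have {B0 B_neq0}B0 : 0 < sqnorm b by rewrite lt_neqAle eq_sym B_neq0.
apply/sqnorm_leP; first by rewrite addr_ge0// ltW.
move=> F; set A := sqnorm a; set B := sqnorm b; pose t := B / A.
have t0 : 0 < t by rewrite divr_gt0.
apply: (@le_trans _ _ ((1 + t) * (\sum_(i <- F) (rnorm (a i)) ^+ 2) +
    (1 + t^-1) * \sum_(i <- F) (rnorm (b i)) ^+ 2)).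
  rewrite !mulr_sumr -big_split/=; apply: ler_sum => i _.
  apply: (@le_trans _ _ ((rnorm (a i) + rnorm (b i)) ^+ 2)).
    by rewrite ler_sqr ?nnegrE ?addr_ge0 ?rnorm_ge0 ?rnormD.
  rewrite -subr_ge0; set x := rnorm (a i); set y := rnorm (b i).
  have -> : (1 + t) * x ^+ 2 + (1 + t^-1) * y ^+ 2 - (x + y) ^+ 2 =
      t^-1 * (t * x - y) ^+ 2.
    by field; rewrite gt_eqF.
  by rewrite mulr_ge0 ?sqr_ge0// invr_ge0 ltW.
have -> : (A + B) ^+ 2 = (1 + t) * A ^+ 2 + (1 + t^-1) * B ^+ 2.
  by rewrite /t; field; rewrite !gt_eqF.
by rewrite lerD// ler_wpM2l ?sqnorm_sum// addr_ge0// ?invr_ge0 ltW.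
Qed.

Lemma sqnormZ_le (c : scalarField R k) a : a \in sqsummable ->
  c *: a \in sqsummable /\ sqnorm (c *: a) <= rnorm c * sqnorm a.
Proof.
move=> sa; apply/sqnorm_leP; first by rewrite mulr_ge0 ?rnorm_ge0 ?sqrtr_ge0.
move=> F; rewrite exprMn.
under eq_bigr do rewrite rnormM exprMn.
by rewrite -mulr_sumr ler_wpM2l ?sqr_ge0 ?sqnorm_sum.
Qed.

Lemma sqnormZ (c : scalarField R k) a : a \in sqsummable ->
  sqnorm (c *: a) = rnorm c * sqnorm a.
Proof.
move=> sa; have [sca le_ca] := sqnormZ_le c sa; apply/eqP; rewrite eq_le le_ca/=.
have [->|c0] := eqVneq c 0; first by rewrite rnorm0 mul0r sqrtr_ge0.
have [_] := sqnormZ_le c^-1 sca; rewrite scalerA mulVf// scale1r => h.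
rewrite (le_trans (ler_wpM2l (rnorm_ge0 _) h))// mulrA -rnormM divff//.
have -> : rnorm (1 : scalarField R k) = 1.
  by apply: (@of_real_inj _ k); rewrite of_real_rnorm normr1; case: k.
by rewrite mul1r.
Qed.

Lemma sqsummable0 : 0 \in sqsummable.
Proof.
apply: (proj1 (proj2 (sqnorm_leP 0 (lexx 0)) _)) => F.
by rewrite big1 ?expr0n// => i _; rewrite rnorm0 expr0n.
Qed.

Fact sqsummable_submod_closed : submod_closed sqsummable.
Proof.
split; first exact: sqsummable0.
by move=> c a b sa sb; have [+ _] := sqnormD (sqnormZ_le c sa).1 sb.
Qed.

HB.instance Definition _ :=
  GRing.isSubmodClosed.Build _ _ sqsummable sqsummable_submod_closed.

Definition ell2 := {a : I -> scalarField R k | a \in sqsummable}.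

HB.instance Definition _ := SubChoice.on ell2.
HB.instance Definition _ := [SubChoice_isSubLmodule of ell2 by <:].

Definition ell2_norm (a : ell2) : scalarField R k := of_real (sqnorm (val a)).

Fact ell2_normD (a b : ell2) : ell2_norm (a + b) <= ell2_norm a + ell2_norm b.
Proof.
rewrite -of_realD ler_of_real; exact: (sqnormD (valP a) (valP b)).2.
Qed.

Fact ell2_normZ (c : scalarField R k) (a : ell2) :
  ell2_norm (c *: a) = `|c| * ell2_norm a.
Proof. by rewrite -of_real_rnorm -of_realM -sqnormZ// (valP a). Qed.

Fact ell2_norm0_eq0 (a : ell2) : ell2_norm a = 0 -> a = 0.
Proof.
rewrite -(of_real0 R k) => /of_real_inj a0; apply: val_inj.
exact: sqnorm_eq0 (valP a) a0.
Qed.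

HB.instance Definition _ := Lmodule_isNormed.Build (scalarField R k) ell2
  ell2_normD ell2_normZ ell2_norm0_eq0.

End SquareSummable.

Arguments sqsummable {R k I}.

Section Operators.
Variables (R : realType) (k : scalar_kind).

Definition bounded_op (U V : normedModType (scalarField R k)) (T : U -> V) :=
  exists M : R, forall x, rnorm (T x) <= M * rnorm x.

Definition invertible_op (U V : normedModType (scalarField R k)) (T : U -> V) :=
  [/\ linear T, bounded_op T &
    exists S : V -> U, [/\ cancel T S, cancel S T & bounded_op S]].

Definition separable (V : normedModType (scalarField R k)) :=
  exists D : set V, countable D /\ dense D.

End Operators.

Section Sequences.
Variables (R : realType) (k : scalar_kind) (I : countType).
Variable (H : completeNormedModType (scalarField R k)).
Implicit Types h f : I -> H.

Definition finitely_supported (c : I -> scalarField R k) :=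
  finite_set [set i | c i != 0].

Definition lin_span h : set H :=
  [set x | exists c : I -> scalarField R k,
     finitely_supported c /\ x = \sum_(i \in [set: I]) c i *: h i].

Definition riesz_basis h :=
  closure (lin_span h) = [set: H] /\
  exists A B : R, [/\ 0 < A, A <= B &
    forall c : I -> scalarField R k, finitely_supported c ->
      A * \sum_(i \in [set: I]) rnorm (c i) ^+ 2
        <= rnorm (\sum_(i \in [set: I]) c i *: h i) ^+ 2
        <= B * \sum_(i \in [set: I]) rnorm (c i) ^+ 2].

(* `{dot H for sconj}` is linear in its first argument and conjugate-linear   *)
(* in its second one.                                                         *)
Variable ip : {dot H for @sconj R k}.

Definition bessel f := exists B : R, forall x : H,
  (\esum_(i in [set: I]) (rnorm (ip x (f i)) ^+ 2)%:E
     <= (B * rnorm x ^+ 2)%:E)%E.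

Fact bessel_sqsummable f : bessel f ->
  forall x, (fun i => ip x (f i)) \in sqsummable.
Proof.
by move=> [B fB] x; apply/sqsummableP; apply: le_lt_trans (fB x) (ltry _).
Qed.

Definition analysis f (fB : bessel f) (x : H) : ell2 R k I :=
  exist _ (fun i => ip x (f i)) (bessel_sqsummable fB x).

(* The adjoint, pointwise: for a bounded operator L on a Hilbert space, the   *)
(* set below is a singleton by the Riesz representation theorem.              *)
Definition adjoint (L : H -> H) (y : H) : H :=
  xget 0 [set z | forall x, ip (L x) y = ip x z].

End Sequences.

(* Main.v *)
(* Since <f_i, L1* x> = <L1 f_i, x>, the operator of the theorem is the analysis
   operator T x = (<x, h_i>)_i of h_i = L1 f_i + L2 g_i, so one has to show that h
   is a Riesz basis iff T is invertible. This is duality between T and the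
   synthesis map c |-> sum c_i h_i. If h is a Riesz basis, then for a in l^2 the
   functional c |-> sum c_i conj(a_i) is bounded with respect to |sum c_i h_i|,
   hence represented by a vector x with T x = a; testing x against the dense span
   bounds |x| by |T x|. Conversely, writing finite coefficients as c = T x and
   using |c|^2 = <sum c_i h_i, x> gives the lower Riesz bound, and a vector has the
   same image under T as its projection onto the closed span, so injectivity of T
   gives density. Adjoints, projections and preimages under T all come from one
   variational form of the Riesz representation theorem. *)
Require Import Defs.
From HB Require Import structures.
From mathcomp Require Import all_boot all_order all_algebra.
From mathcomp Require Import complex finmap ring lra.
From mathcomp Require Import all_classical all_reals all_analysis.

Set Implicit Arguments.
Unset Strict Implicit.
Unset Printing Implicit Defensive.

Import Order.TTheory GRing.Theory Num.Theory.
Import numFieldNormedType.Exports.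

Local Open Scope classical_set_scope.
Local Open Scope ring_scope.

(** * Scalars, and convergence and closure measured by real-valued norms *)

Section Scalars.
Variables (R : realType) (k : scalar_kind).
Local Notation K := (scalarField R k).
Implicit Types x y : K.

Fact sconj_is_zmod_morphism : zmod_morphism (@sconj R k).
Proof. by case: k => //= x y; rewrite rmorphB. Qed.

Fact sconj_is_monoid_morphism : monoid_morphism (@sconj R k).
Proof. by case: k => //=; split=> [|x y]; rewrite ?rmorph1// rmorphM. Qed.

HB.instance Definition _ := GRing.isZmodMorphism.Build K K (@sconj R k)
  sconj_is_zmod_morphism.
HB.instance Definition _ := GRing.isMonoidMorphism.Build K K (@sconj R k)
  sconj_is_monoid_morphism.

Lemma sconjM x y : sconj (x * y) = sconj x * sconj y.
Proof. exact: rmorphM. Qed.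

Lemma sconjN x : sconj (- x) = - sconj x.
Proof. exact: rmorphN. Qed.

Lemma sconjK : involutive (@sconj R k).
Proof. by case: k => //= x; rewrite conjCK. Qed.

Lemma sconj_of_real (r : R) : sconj (of_real r) = of_real r :> K.
Proof. by case: k => //=; apply: conjc_real. Qed.

Lemma mul_sconj x : x * sconj x = of_real (rnorm x ^+ 2).
Proof.
rewrite expr2 of_realM of_real_rnorm -expr2.
by case: k x => /= x; [rewrite real_normK ?num_real// expr2 | rewrite normCK].
Qed.

Lemma reD x y : re (x + y) = re x + re y.
Proof. by case: k x y => //= x y; rewrite raddfD. Qed.

Lemma reN x : re (- x) = - re x.
Proof. by case: k x => //= x; rewrite raddfN. Qed.

Lemma re_sconj x : re (sconj x) = re x.
Proof. by case: k x => //= -[]. Qed.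

Lemma re_of_real (r : R) : re (of_real r : K) = r.
Proof. by case: k. Qed.

Lemma reMl (r : R) x : re (of_real r * x) = r * re x.
Proof. by case: k x => //= -[a b] /=; rewrite mul0r subr0. Qed.

Lemma re_le_rnorm x : re x <= rnorm x.
Proof.
rewrite -(@ler_of_real R k) of_real_rnorm; case: k x => /= x.
  exact: ler_norm.
by apply: le_trans (normc_ge_Re x); rewrite lecR ler_norm.
Qed.

Lemma rnorm_of_real (r : R) : 0 <= r -> rnorm (of_real r : K) = r.
Proof.
move=> r0; apply: (@of_real_inj _ k); rewrite of_real_rnorm ger0_norm//.
by rewrite of_real_ge0.
Qed.

Lemma rnorm_sconj x : rnorm (sconj x) = rnorm x.
Proof.
apply/eqP; rewrite -(@eqrXn2 _ 2)// ?rnorm_ge0//; apply/eqP.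
by apply: (@of_real_inj _ k); rewrite -!mul_sconj sconjK mulrC.
Qed.

Lemma of_real_gt0 (r : R) : (0 < of_real r :> K) = (0 < r).
Proof. by rewrite !lt_def of_real_ge0 -(of_real0 R k) (inj_eq (@of_real_inj _ k)). Qed.

Lemma rnormN (V : normedZmodType K) (v : V) : rnorm (- v) = rnorm v.
Proof. by rewrite /rnorm normrN. Qed.

Lemma rnormB (V : normedZmodType K) (u v : V) : rnorm (u - v) = rnorm (v - u).
Proof. by rewrite -rnormN opprB. Qed.

Lemma rnormZ (V : normedModType K) (a : K) (v : V) :
  rnorm (a *: v) = rnorm a * rnorm v.
Proof. by apply: (@of_real_inj _ k); rewrite of_realM !of_real_rnorm normrZ. Qed.

Lemma gt0_of_realE (e : K) : 0 < e -> exists2 r : R, 0 < r & e = of_real r.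
Proof.
move=> e0; have er : e = of_real (rnorm e) by rewrite of_real_rnorm gtr0_norm.
by exists (rnorm e) => //; rewrite -of_real_gt0 -er.
Qed.

Lemma ltr_of_real (r s : R) : (of_real r < of_real s :> K) = (r < s).
Proof. by rewrite !lt_def ler_of_real (inj_eq (@of_real_inj _ k)). Qed.

(** Bridges filter convergence, whose radii lie in [K], and epsilon-N arguments with radii in
    [R]. *)
Lemma rnorm_cauchy_cvg (H : completeNormedModType K) (u : nat -> H) :
  (forall e : R, 0 < e -> exists N, forall m n, (N <= m)%N -> (N <= n)%N ->
     rnorm (u m - u n) < e) ->
  exists x : H, forall e : R, 0 < e -> exists N, forall n, (N <= n)%N ->
     rnorm (x - u n) < e.
Proof.
move=> uC; have : cvg (u @ \oo).
  apply: cauchy_cvg; apply: cauchy_exP => e /gt0_of_realE[r r0 ->].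
  have [N uN] := uC _ r0; exists (u N); exists N => // n /= Nn.
  by rewrite -ball_normE /= -of_real_rnorm ltr_of_real uN.
move=> /cvg_ex[x /cvgrPdist_lt ux]; exists x => e e0.
have /ux[N _ uN] : 0 < of_real e :> K by rewrite of_real_gt0.
by exists N => n /uN /=; rewrite -of_real_rnorm ltr_of_real.
Qed.

Lemma closure_rnormP (H : normedModType K) (A : set H) (x : H) :
  closure A x <-> forall e : R, 0 < e -> exists2 y, A y & rnorm (x - y) < e.
Proof.
split=> [Ax e e0|Ax B /nbhs_normP[e /= /gt0_of_realE[r r0 ->] xB]].
  have e0' : 0 < of_real e :> K by rewrite of_real_gt0.
  have [y [Ay]] := Ax _ (nbhs_ball_norm x (PosNum e0')).
  by rewrite /= -of_real_rnorm ltr_of_real; exists y.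
have [y Ay xy] := Ax _ r0; exists y; split=> //; apply: xB.
by rewrite /= -of_real_rnorm ltr_of_real.
Qed.

End Scalars.

(* AM-GM with weights [Q / P] and [P / Q]; when [P] or [Q] vanishes, both are
   first enlarged by a small [d]. *)
Lemma sum_mul_le (R : realFieldType) (I : Type) (s : seq I) (x y : I -> R)
    (P Q : R) : 0 <= P -> 0 <= Q ->
  \sum_(i <- s) x i ^+ 2 <= P ^+ 2 -> \sum_(i <- s) y i ^+ 2 <= Q ^+ 2 ->
  \sum_(i <- s) x i * y i <= P * Q.
Proof.
move=> P0 Q0 xP yQ; apply/ler_addgt0Pr => e e0.
suff main P' Q' : 0 < P' -> 0 < Q' -> \sum_(i <- s) x i ^+ 2 <= P' ^+ 2 ->
    \sum_(i <- s) y i ^+ 2 <= Q' ^+ 2 -> \sum_(i <- s) x i * y i <= P' * Q'.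
  pose d := Num.min 1 (e / (P + Q + 1)).
  have S0 : 0 < P + Q + 1 by lra.
  have d0 : 0 < d by rewrite lt_min ltr01 divr_gt0.
  have d1 : d <= 1 by rewrite ge_min lexx.
  have de : d * (P + Q + 1) <= e by rewrite -ler_pdivlMr// ge_min lexx orbT.
  apply: (@le_trans _ _ ((P + d) * (Q + d))).
    by apply: main; [lra | lra | nra | nra].
  by nra.
move=> P'0 Q'0 xP' yQ'.
rewrite -(@ler_pM2l _ 2)// mulr_sumr.
apply: (@le_trans _ _ (\sum_(i <- s) (Q' / P' * x i ^+ 2 + P' / Q' * y i ^+ 2))).
  apply: ler_sum => i _; rewrite -subr_ge0.
  have -> : Q' / P' * x i ^+ 2 + P' / Q' * y i ^+ 2 - 2 * (x i * y i) =
      (Q' * x i - P' * y i) ^+ 2 / (P' * Q').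
    by field; rewrite !gt_eqF.
  by rewrite divr_ge0 ?sqr_ge0// ltW// mulr_gt0.
rewrite big_split/= -!mulr_sumr.
apply: (@le_trans _ _ (Q' / P' * P' ^+ 2 + P' / Q' * Q' ^+ 2)).
  by rewrite lerD// ler_wpM2l// divr_ge0// ltW.
suff -> : Q' / P' * P' ^+ 2 + P' / Q' * Q' ^+ 2 = 2 * (P' * Q') by [].
by field; rewrite !gt_eqF.
Qed.

(** * Cauchy-Schwarz, Riesz representation and adjoints *)

Section InnerProduct.
Variables (R : realType) (k : scalar_kind).
Local Notation K := (scalarField R k).
Variables (H : completeNormedModType K) (ip : {dot H for @sconj R k}).
Hypothesis ip_norm : forall x : H, ip x x = `|x| ^+ 2.
Implicit Types x y : H.

Lemma ipC x y : ip x y = sconj (ip y x).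
Proof. by rewrite (hermC ip) expr0 mul1r. Qed.

Lemma ipDl x y z : ip (x + y) z = ip x z + ip y z.
Proof. exact: linearDl. Qed.

Lemma ipZl a x z : ip (a *: x) z = a * ip x z.
Proof. exact: linearZl_LR. Qed.

Lemma ipZr a x z : ip x (a *: z) = sconj a * ip x z.
Proof. exact: linearZr_LR. Qed.

Lemma ip_rnorm x : ip x x = of_real (rnorm x ^+ 2).
Proof. by rewrite ip_norm -of_real_rnorm expr2 -of_realM -expr2. Qed.

Lemma sqr_rnormD x y :
  rnorm (x + y) ^+ 2 = rnorm x ^+ 2 + rnorm y ^+ 2 + 2 * re (ip x y).
Proof.
rewrite -[LHS](re_of_real k) -ip_rnorm ipDl !linearDr /= !ip_rnorm.
by rewrite (ipC y x) !reD !re_of_real re_sconj; ring.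
Qed.

Lemma rnorm_ip x y : rnorm (ip x y) <= rnorm x * rnorm y.
Proof.
have [y0|y0] := eqVneq (rnorm y) 0.
  by rewrite (rnorm0_eq0 y0) linear0r !rnorm0 mulr0.
have {}y0 : 0 < rnorm y by rewrite lt_neqAle eq_sym y0 rnorm_ge0.
set d := ip x y; pose r := (rnorm y ^+ 2)^-1.
have r0 : 0 < r by rewrite invr_gt0 exprn_gt0.
(* The vector is the component of [x] orthogonal to [y]. *)
have := sqr_ge0 (rnorm (x + (- of_real r * d) *: y)).
rewrite sqr_rnormD ipZr -/d sconjM sconjN sconj_of_real -mulrA.
rewrite (mulrC (sconj d)) mul_sconj !mulNr reN reMl re_of_real.
rewrite rnormZ rnormN rnormM (rnorm_of_real _ (ltW r0)) => h.
rewrite -ler_sqr ?nnegrE ?mulr_ge0 ?rnorm_ge0// exprMn.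
have ry : r * rnorm y ^+ 2 = 1 by rewrite mulVf// gt_eqF// exprn_gt0.
have : 0 <= rnorm x ^+ 2 - r * rnorm d ^+ 2.
  rewrite (le_trans h)// !exprMn.
  have -> : r ^+ 2 * rnorm d ^+ 2 * rnorm y ^+ 2 =
    (r * rnorm y ^+ 2) * (r * rnorm d ^+ 2) by ring.
  by rewrite ry; lra.
rewrite -(pmulr_lge0 _ (exprn_gt0 2 y0)) mulrBl (mulrAC r) ry mul1r.
by rewrite subr_ge0.
Qed.

(* The subspace of [H] on which the functional lives is parametrised by [q] on
   [P]: with [q = id] this is the classical Riesz theorem, while with [q] a
   synthesis map it represents a functional given on coefficients, without
   having to descend to the span or to extend by density. *)
Lemma riesz_representation (V : lmodType K) (P : set V) (q : V -> H) (phi : V -> K) (C : R) :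
  P 0 ->
  (forall a u v, P u -> P v -> P (a *: u + v)) ->
  (forall a u v, P u -> P v -> q (a *: u + v) = a *: q u + q v) ->
  (forall a u v, P u -> P v -> phi (a *: u + v) = a * phi u + phi v) ->
  (forall v, P v -> rnorm (phi v) <= C * rnorm (q v)) ->
  exists x : H, closure (q @` P) x /\ forall v, P v -> phi v = ip (q v) x.
Proof.
move=> P0 Plin qlin philin phiC.
(* If a vector [x] of the closed image represents [phi], then [J v = |q v - x|^2 - |x|^2], so
   minimising [J] drives [q v] towards [x]. *)
pose J v := rnorm (q v) ^+ 2 - 2 * re (phi v).
(* Bound [re (phi v)] by [C |q v|] and complete the square. *)
have J_lb : lbound (J @` P) (- C ^+ 2).
  move=> _ [v Pv <-]; rewrite /J.
  have := le_trans (re_le_rnorm (phi v)) (phiC v Pv).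
  by have := sqr_ge0 (rnorm (q v) - C); rewrite sqrrB -mulrnAr; lra.
set m := inf (J @` P).
have J_ge v : P v -> m <= J v.
  by move=> Pv; apply: ge_inf; [exists (- C ^+ 2) | exists v].
(* Parallelogram law: minimising sequences of [J] are Cauchy through [q]. *)
have J_dist u v : P u -> P v ->
    rnorm (q v - q u) ^+ 2 <= 2 * (J u - m) + 2 * (J v - m).
  move=> Pu Pv; pose h : K := of_real (2^-1).
  have Pd : P (-1 *: u + v) by apply: Plin.
  (* The competitor is the midpoint of [u] and [v], written [u + (v - u) / 2] to fit [Plin]. *)
  have := J_ge _ (Plin h _ _ Pd Pu); rewrite /J.
  rewrite (qlin _ _ _ Pd Pu) (qlin _ _ _ Pu Pv).
  rewrite (philin _ _ _ Pd Pu) (philin _ _ _ Pu Pv).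
  rewrite mulN1r scaleN1r (addrC (- q u)) (addrC _ (q u)) (sqr_rnormD _ (h *: _)).
  have h0 : 0 <= 2^-1 :> R by rewrite invr_ge0.
  rewrite rnormZ (rnorm_of_real _ h0) ipZr sconj_of_real !reMl reD reMl reD reN.
  have := sqr_rnormD (q u) (q v - q u); rewrite addrCA subrr addr0 => ->.
  move: (rnorm (q u)) (rnorm _) (re _) (re _) (re _) => a b c d e.
  by rewrite exprMn; lra.
(* At a near-minimiser [u] the gradient of [J] nearly vanishes in every direction
   [v]: move [u] by a small multiple of [- sconj d *: v]. *)
have J_grad u v : P u -> P v ->
    rnorm (ip (q v) (q u) - phi v) ^+ 2 <= (J u - m) * (rnorm (q v) ^+ 2 + 1).
  move=> Pu Pv; set d := ip _ _ - _; pose N := rnorm (q v) ^+ 2 + 1.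
  have N0 : 0 < N by rewrite ltr_wpDl// sqr_ge0.
  (* With this step length the second-order term [s^2 |d|^2 |q v|^2] is at most [s |d|^2], half of
     the first-order decrease, so [J] drops by at least [s |d|^2]. *)
  pose s := N^-1; have s0 : 0 < s by rewrite invr_gt0.
  have := J_ge _ (Plin (- (of_real s * sconj d)) _ _ Pv Pu).
  rewrite /J qlin// philin// sqr_rnormD.
  rewrite rnormZ rnormN rnormM (rnorm_of_real _ (ltW s0)) rnorm_sconj.
  rewrite ipZl !mulNr -!mulrA => h.
  have key : re (of_real s * (sconj d * ip (q v) (q u))) -
      re (of_real s * (sconj d * phi v)) = s * rnorm d ^+ 2.
    by rewrite -reN -reD -mulrBr -mulrBr -/d (mulrC (sconj d)) mul_sconj
      -of_realM re_of_real.
  have sN : s * N = 1 by rewrite mulVf// gt_eqF.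
  have : s * rnorm d ^+ 2 <= J u - m.
    move: h; rewrite !(reD, reN) /J !exprMn /N in key sN *.
    move: (re _) (re _) (re _) (rnorm (q u)) (rnorm (q v)) (rnorm d) (m)
      key sN s0.
    move=> a b c U V' D M key sN' s0' h.
    have : s ^+ 2 * D ^+ 2 * V' ^+ 2 = (s * (V' ^+ 2 + 1)) * (s * D ^+ 2)
      - s ^+ 2 * D ^+ 2 by ring.
    rewrite sN'; have := mulr_ge0 (sqr_ge0 s) (sqr_ge0 D); lra.
  by rewrite -(ler_pM2r N0) mulrAC sN mul1r.
have /choice[u uP] : forall n : nat, exists v, P v /\ J v - m < n.+1%:R^-1.
  move=> n.
  have n0 : 0 < n.+1%:R^-1 :> R by [].
  have Jinf : has_inf (J @` P).
    by split; [exists (J 0); exists 0 | exists (- C ^+ 2)].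
  have [_ [v Pv <-] Jv] := inf_adherent n0 Jinf.
  by exists v; split=> //; rewrite ltrBlDl.
have small e : 0 < e -> exists N, forall n, (N <= n)%N -> J (u n) - m < e.
  move=> e0; have [N _ Ne] := near_infty_natSinv_lt (PosNum e0).
  by exists N => n /Ne; apply: lt_trans; exact: (uP n).2.
have [x ux] : exists x : H, forall e : R, 0 < e -> exists N, forall n,
    (N <= n)%N -> rnorm (x - q (u n)) < e.
  apply: rnorm_cauchy_cvg => e e0.
  (* [J_dist] adds two such errors, each doubled, for a total of [e ^+ 2]. *)
  have [|N uN] := small (e ^+ 2 / 4); first by rewrite divr_gt0// exprn_gt0.
  exists N => a b /uN ua /uN ub.
  rewrite -ltr_sqr ?nnegrE ?rnorm_ge0// ?ltW//.
  by have := J_dist _ _ (uP b).1 (uP a).1; lra.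
exists x; split.
  apply/closure_rnormP => e /ux[N uN]; exists (q (u N)); last exact: uN.
  by exists (u N) => //; exact: (uP N).1.
move=> v Pv; apply/eqP; rewrite -subr_eq0; apply/eqP/rnorm0_eq0/eqP.
rewrite eq_le rnorm_ge0 andbT; apply/ler_addgt0Pr => e e0; rewrite add0r.
pose N := rnorm (q v) ^+ 2 + 1.
have N0 : 0 < N by rewrite ltr_wpDl// sqr_ge0.
have [|n1 un1] := small ((e / 2) ^+ 2 / N); first by rewrite divr_gt0 ?exprn_gt0 ?divr_gt0.
have M0 : 0 < rnorm (q v) + 1 by rewrite ltr_wpDl// rnorm_ge0.
have [|n2 un2] := ux (e / 2 / (rnorm (q v) + 1)); first by rewrite !divr_gt0.
pose n := maxn n1 n2.
(* The first term is the gradient at [u n], small by [J_grad]; the second is small by Cauchy-Schwarz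
   and convergence. *)
have -> : phi v - ip (q v) x =
    - (ip (q v) (q (u n)) - phi v) - ip (q v) (x - q (u n)).
  by rewrite linearBr; ring.
rewrite (le_trans (rnormD _ _))// !rnormN (splitr e) lerD//.
  rewrite -ler_sqr ?nnegrE ?rnorm_ge0 ?divr_ge0 ?(ltW e0)//.
  rewrite (le_trans (J_grad _ _ (uP n).1 Pv))// -/N -ler_pdivlMr//.
  by rewrite ltW// un1// leq_maxl.
rewrite (le_trans (rnorm_ip _ _))//.
have := un2 n (leq_maxr _ _); rewrite ltr_pdivlMr// => /ltW; apply: le_trans.
rewrite mulrC ler_wpM2l ?rnorm_ge0//.
by rewrite lerDl.
Qed.

(** [adjoint] falls back on 0 only if no vector has its defining property; representing
    [x |-> <L x, y>] on all of [H] excludes that case. *)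
Lemma ip_adjointE (L : {linear H -> H}) : bounded_op L ->
  forall x y, ip (L x) y = ip x (adjoint ip L y).
Proof.
move=> [M LM] x y; rewrite /adjoint; case: xgetP => [z _ /(_ x)//|nz].
have [//|//|//|a u v _ _|v _|z [_ zP]] :=
    @riesz_representation H setT id (fun x => ip (L x) y) (M * rnorm y).
- by rewrite linearP ipDl ipZl.
- rewrite (le_trans (rnorm_ip _ _))// mulrAC.
  by rewrite ler_wpM2r ?rnorm_ge0.
- by case: (nz z) => u; apply: zP.
Qed.

End InnerProduct.

(** * Finite sums, finitely supported families and truncation *)

Section FiniteSums.
Variables (R : realType) (k : scalar_kind) (I : countType).
Local Notation K := (scalarField R k).
Implicit Types (F : {fset I}) (c d : I -> K).

Lemma finitely_supportedP c :
  finitely_supported c <-> exists F, forall i, i \notin F -> c i = 0.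
Proof.
split=> [fc|[F cF]].
  exists (fset_set [set i | c i != 0]) => i.
  by rewrite in_fset_set// notin_setE => /negP; rewrite negbK => /eqP.
apply: (finite_subfset F) => i /=; apply: contra_neqT; exact: cF.
Qed.

Lemma finitely_supported_common c d : finitely_supported c -> finitely_supported d ->
  exists F, forall i, i \notin F -> c i = 0 /\ d i = 0.
Proof.
move=> /finitely_supportedP[F cF] /finitely_supportedP[G dG].
by exists (F `|` G)%fset => i; rewrite in_fsetU negb_or => /andP[/cF-> /dG->].
Qed.

Definition fset_restrict F c : I -> K := fun i => if i \in F then c i else 0.

Lemma finitely_supported_fset_restrict F c : finitely_supported (fset_restrict F c).
Proof. by apply/finitely_supportedP; exists F => i /negPf iF; rewrite /fset_restrict iF. Qed.

(** A partial sum over [G] only sees the indices common to [F] and [G], so it never exceeds the sum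
    over [F]. *)
Lemma fset_restrict_sqnorm F c : fset_restrict F c \in sqsummable /\
  sqnorm (fset_restrict F c) <= Num.sqrt (\sum_(i <- F) rnorm (c i) ^+ 2).
Proof.
apply/sqnorm_leP; first exact: sqrtr_ge0.
move=> G; rewrite sqr_sqrtr; last by apply: sumr_ge0 => i _; exact: sqr_ge0.
have -> : \sum_(i <- G) rnorm (fset_restrict F c i) ^+ 2 =
    \sum_(i <- G | i \in F) rnorm (c i) ^+ 2.
  rewrite [RHS]big_mkcond; apply: eq_bigr => i _; rewrite /fset_restrict.
  by case: ifP => // _; rewrite rnorm0 expr0n.
rewrite -big_filter (perm_big [seq i <- F | i \in G]).
  rewrite big_filter big_mkcond; apply: ler_sum => i _.
  by case: ifP => // _; exact: sqr_ge0.
apply: uniq_perm; rewrite ?filter_uniq ?fset_uniq// => i.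
by rewrite !mem_filter andbC.
Qed.

Lemma fsum_comb (M : lmodType K) (e : I -> M) (a : K) c d :
  finitely_supported c -> finitely_supported d ->
  \sum_(i \in [set: I]) (a *: c + d) i *: e i =
  a *: (\sum_(i \in [set: I]) c i *: e i) + \sum_(i \in [set: I]) d i *: e i.
Proof.
move=> fc fd; have [F cdF] := finitely_supported_common fc fd.
rewrite !(fsbigTE F) => [|i /cdF[_ ->]|i /cdF[-> _]|i /cdF[ci di]].
- rewrite scaler_sumr -big_split/=; apply: eq_bigr => i _.
  by rewrite scalerDl scalerA.
- by rewrite scale0r.
- by rewrite scale0r.
- have -> : (a *: c + d) i = a * c i + d i by [].
  by rewrite ci di mulr0 addr0 scale0r.
Qed.

Lemma fsum_delta (M : lmodType K) (e : I -> M) (j : I) :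
  \sum_(i \in [set: I]) (i == j)%:R *: e i = e j.
Proof.
rewrite (fsbigTE [fset j]%fset) ?big_seq_fset1 ?eqxx ?scale1r// => i.
by rewrite in_fset1 => /negPf ->; rewrite scale0r.
Qed.

Lemma finitely_supported_delta j : finitely_supported (fun i : I => (i == j)%:R : K).
Proof.
apply/finitely_supportedP; exists [fset j]%fset => i.
by rewrite in_fset1 => /negPf ->.
Qed.

Lemma finitely_supported_comb (a : K) c d :
  finitely_supported c -> finitely_supported d -> finitely_supported (a *: c + d).
Proof.
move=> fc fd; have [F cdF] := finitely_supported_common fc fd.
apply/finitely_supportedP; exists F => i /cdF[ci di].
have -> : (a *: c + d) i = a * c i + d i by [].
by rewrite ci di mulr0 addr0.
Qed.

(** Cauchy-Schwarz with bounds [P] and [Q] in place of the norms, so that the norm of an l^2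
    sequence can stand for that of its part on [F]. *)
Lemma rnorm_sum_mul_le F c d (P Q : R) : 0 <= P -> 0 <= Q ->
  \sum_(i <- F) rnorm (c i) ^+ 2 <= P ^+ 2 ->
  \sum_(i <- F) rnorm (d i) ^+ 2 <= Q ^+ 2 ->
  rnorm (\sum_(i <- F) c i * d i) <= P * Q.
Proof.
move=> P0 Q0 cP dQ; apply: (le_trans _ (sum_mul_le P0 Q0 cP dQ)).
elim/big_ind2: _ => [|x X y Y xX yY|i _]; first by rewrite rnorm0.
- by rewrite (le_trans (rnormD _ _))// lerD.
- by rewrite rnormM.
Qed.

Lemma sum_mul_sconj F c :
  \sum_(i <- F) c i * sconj (c i) = of_real (\sum_(i <- F) rnorm (c i) ^+ 2).
Proof.
elim/big_ind2: _ => [|x X y Y -> ->|i _]; first by rewrite of_real0.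
- by rewrite of_realD.
- by rewrite mul_sconj.
Qed.

End FiniteSums.

(** * Riesz bases and invertibility of the analysis operator *)

Section AnalysisRieszBasis.
Variables (R : realType) (k : scalar_kind) (I : countType).
Local Notation K := (scalarField R k).
Variables (H : completeNormedModType K) (ip : {dot H for @sconj R k}).
Hypothesis ip_norm : forall x : H, ip x x = `|x| ^+ 2.
Variables (h : I -> H) (T : H -> ell2 R k I).
Hypothesis TE : forall x i, val (T x) i = ip x (h i).
Implicit Types (F : {fset I}) (c : I -> K) (x : H).

(** For [y] in [A] near [x], [|x|^2 = <x, y> + <x, x - y> <= C |x| + (C + |x|) |x - y|], whence the
    tolerance [e / (C + rnorm x)]. *)
Lemma ip_dense_le (A : set H) x (C : R) : closure A x -> 0 <= C ->
  (forall y, A y -> rnorm (ip x y) <= C * rnorm y) -> rnorm x <= C.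
Proof.
move=> Ax C0 AC; have [->//|x0] := eqVneq (rnorm x) 0.
have {}x0 : 0 < rnorm x by rewrite lt_neqAle eq_sym x0 rnorm_ge0.
rewrite -(ler_pM2l x0); apply/ler_addgt0Pr => e e0.
have S0 : 0 < C + rnorm x by rewrite ltr_wpDl.
have [|y Ay xy] := (closure_rnormP A x).1 Ax (e / (C + rnorm x)).
  by rewrite divr_gt0.
have {}xy : rnorm (x - y) * (C + rnorm x) <= e.
  by rewrite -ler_pdivlMr// ltW.
have -> : rnorm x * rnorm x = rnorm (ip x x).
  by rewrite ip_rnorm// rnorm_of_real ?sqr_ge0// expr2.
have -> : ip x x = ip x y + ip x (x - y) by rewrite -linearDr addrC subrK.
have := rnormD (ip x y) (ip x (x - y)).
have := AC y Ay; have := rnorm_ip ip_norm x (x - y).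
have := rnormD (y - x) x; rewrite subrK (rnormB y x).
move: (rnorm y) (rnorm (x - y)) xy => Y Z xy h1 h2 h3 h4.
have : C * Y <= C * (Z + rnorm x) by rewrite ler_wpM2l.
by lra.
Qed.

(** Synthesis is the formal adjoint of [T]; the duality estimates below rest on this. *)
Lemma ip_fsum F c x :
  ip (\sum_(i <- F) c i *: h i) x = \sum_(i <- F) c i * sconj (val (T x) i).
Proof.
rewrite (big_morph (ip^~ x) (fun u v => ipDl ip u v x) (linear0l _ _)).
apply: eq_bigr => i _.
by rewrite ipZl ipC TE.
Qed.

Lemma rnorm_analysisE x : rnorm (T x) = sqnorm (val (T x)).
Proof. exact: re_of_real. Qed.

Lemma rnorm_ip_fsum_le F c x :
  rnorm (ip (\sum_(i <- F) c i *: h i) x) <=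
  Num.sqrt (\sum_(i <- F) rnorm (c i) ^+ 2) * rnorm (T x).
Proof.
rewrite ip_fsum rnorm_analysisE; apply: rnorm_sum_mul_le; rewrite ?sqrtr_ge0//.
  by rewrite sqr_sqrtr// sumr_ge0// => i _; exact: sqr_ge0.
under eq_bigr do rewrite rnorm_sconj.
exact: sqnorm_sum (valP (T x)).
Qed.

Lemma analysis_linear : linear T.
Proof.
move=> a x y; apply: val_inj; apply/funext => i.
by rewrite TE ipDl ipZl -!TE.
Qed.

(** Arbitrary coefficients are summed over a finite set, so that those of [T x] can be inserted
    without truncation. *)
Definition riesz_bounds (A B : R) := forall F c,
  A * \sum_(i <- F) rnorm (c i) ^+ 2
    <= rnorm (\sum_(i <- F) c i *: h i) ^+ 2
    <= B * \sum_(i <- F) rnorm (c i) ^+ 2.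

Lemma riesz_boundsP (A B : R) : riesz_bounds A B <->
  forall c, finitely_supported c ->
      A * \sum_(i \in [set: I]) rnorm (c i) ^+ 2
        <= rnorm (\sum_(i \in [set: I]) c i *: h i) ^+ 2
        <= B * \sum_(i \in [set: I]) rnorm (c i) ^+ 2.
Proof.
split=> [AB c /finitely_supportedP[F cF]|AB F c].
  rewrite !(fsbigTE F)// => i /cF ->; first by rewrite scale0r.
  by rewrite rnorm0 expr0n.
have := AB _ (finitely_supported_fset_restrict F c).
rewrite !(fsbigTE F) => [|i|i]; last 2 first.
- by rewrite /fset_restrict => /negPf ->; rewrite scale0r.
- by rewrite /fset_restrict => /negPf ->; rewrite rnorm0 expr0n.
have cF i : i \in F -> fset_restrict F c i = c i by rewrite /fset_restrict => ->.
rewrite (eq_big_seq (fun i => rnorm (c i) ^+ 2)) => [|i /cF ->//].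
by rewrite (eq_big_seq (fun i => c i *: h i)) => // i /cF ->.
Qed.

(** With [c = T x] and [y] the sum of [c_i h_i] over [F], [S = <y, x>] gives
    [S^2 <= |y|^2 |x|^2 <= B S |x|^2]; cancelling [S] bounds each partial sum of [|T x|^2]. *)
Lemma analysis_bounded (A B : R) : 0 <= B -> riesz_bounds A B -> bounded_op T.
Proof.
move=> B0 AB; exists (Num.sqrt B) => x; rewrite rnorm_analysisE.
apply: (proj2 (proj2 (sqnorm_leP _ _) _)).
  by rewrite mulr_ge0 ?sqrtr_ge0 ?rnorm_ge0.
move=> F; rewrite exprMn sqr_sqrtr//.
set c := val (T x); set S := \sum_(i <- F) _.
have S0 : 0 <= S by apply: sumr_ge0 => i _; exact: sqr_ge0.
have [->|Sn0] := eqVneq S 0; first by rewrite mulr_ge0// sqr_ge0.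
have {Sn0}S0 : 0 < S by rewrite lt_neqAle eq_sym Sn0.
set y := \sum_(i <- F) c i *: h i.
have Sy : S <= rnorm y * rnorm x.
  rewrite -(rnorm_of_real k (ltW S0)) /S -sum_mul_sconj -ip_fsum.
  exact: rnorm_ip.
have /andP[_ yB] := AB F c; rewrite -/y -/S in yB.
rewrite -(ler_pM2r S0) -expr2.
apply: (@le_trans _ _ ((rnorm y * rnorm x) ^+ 2)).
  by rewrite ler_sqr// ?nnegrE ?mulr_ge0 ?rnorm_ge0// ltW.
by rewrite exprMn (mulrAC B) ler_wpM2r ?sqr_ge0.
Qed.

Lemma sqrt_riesz_lower (A B : R) F c : 0 < A -> riesz_bounds A B ->
  Num.sqrt (\sum_(i <- F) rnorm (c i) ^+ 2) <=
  (Num.sqrt A)^-1 * rnorm (\sum_(i <- F) c i *: h i).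
Proof.
move=> A0 AB; have /andP[+ _] := AB F c.
rewrite mulrC -ler_pdivlMr// => cA.
rewrite -ler_sqr ?nnegrE ?sqrtr_ge0 ?mulr_ge0 ?invr_ge0 ?sqrtr_ge0 ?rnorm_ge0//.
rewrite sqr_sqrtr; last by apply: sumr_ge0 => i _; exact: sqr_ge0.
by rewrite exprMn exprVn (sqr_sqrtr (ltW A0)) mulrC.
Qed.

(** For [y] in the span with coefficients [c], [|<x, y>| <= |c| |T x| <= A^(-1/2) |y| |T x|];
    density turns this into a bound on [|x|]. *)
Lemma analysis_below (A B : R) x : 0 < A -> riesz_bounds A B ->
  closure (lin_span h) = [set: H] ->
  rnorm x <= (Num.sqrt A)^-1 * rnorm (T x).
Proof.
move=> A0 AB hdense; apply: (@ip_dense_le (lin_span h)).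
- by rewrite hdense.
- by rewrite mulr_ge0 ?invr_ge0 ?sqrtr_ge0 ?rnorm_ge0.
move=> _ [c [/finitely_supportedP[F cF] ->]].
rewrite (fsbigTE F) => [|i /cF ->]; last by rewrite scale0r.
rewrite ipC rnorm_sconj (le_trans (rnorm_ip_fsum_le _ _ _))//.
by rewrite mulrAC ler_wpM2r ?rnorm_ge0// (sqrt_riesz_lower _ _ A0 AB).
Qed.

Lemma analysis_surjective (A B : R) (a : ell2 R k I) : 0 < A ->
  riesz_bounds A B -> exists x, T x = a.
Proof.
move=> A0 AB.
pose q c := \sum_(i \in [set: I]) c i *: h i.
(* Scalars are viewed in the module [K^o] so that [fsum_comb] gives linearity of [phi] as well as of
   [q]. *)
pose phi c : K := \sum_(i \in [set: I]) c i *: (sconj (val a i) : K^o).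
have [||u v w fv fw|u v w fv fw|c|x [_ xP]] := @riesz_representation _ _ _ _ ip_norm
    (I -> K) (@finitely_supported R k I) q phi (sqnorm (val a) * (Num.sqrt A)^-1).
- by apply/finitely_supportedP; exists fset0.
- exact: finitely_supported_comb.
- exact: fsum_comb.
- exact: fsum_comb.
- move=> /finitely_supportedP[F cF]; rewrite /phi /q.
  rewrite !(fsbigTE F) => [|i /cF ->|i /cF ->]; rewrite ?scale0r//.
  rewrite -mulrA; apply: le_trans (_ : sqnorm (val a) *
    Num.sqrt (\sum_(i <- F) rnorm (c i) ^+ 2) <= _).
    rewrite mulrC; apply: rnorm_sum_mul_le; rewrite ?sqrtr_ge0//.
      by rewrite sqr_sqrtr// sumr_ge0// => i _; exact: sqr_ge0.
    under eq_bigr do rewrite rnorm_sconj.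
    exact: sqnorm_sum (valP a).
  by rewrite ler_wpM2l ?sqrtr_ge0// (sqrt_riesz_lower _ _ A0 AB).
(* At the unit family of index [i] the representation reads [<h_i, x> = conj(a_i)]. *)
exists x; apply: val_inj; apply/funext => i; rewrite TE ipC.
have := xP _ (finitely_supported_delta R k i); rewrite /q /phi !fsum_delta => <-.
by rewrite sconjK.
Qed.

(** The lower bound on [T] serves twice: it gives injectivity and, read at [S a], boundedness of the
    inverse. *)
Lemma riesz_basis_invertible : riesz_basis h -> invertible_op T.
Proof.
move=> [hdense [A [B [A0 AB /riesz_boundsP bnd]]]].
have B0 : 0 <= B by rewrite (le_trans (ltW A0)).
have below x := analysis_below x A0 bnd hdense.
split; [exact: analysis_linear|exact: analysis_bounded bnd|].
have /choice[S ST] : forall a, exists x, T x = a.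
  by move=> a; exact: analysis_surjective bnd.
have Tinj : injective T.
  move=> x y Txy; apply/eqP; rewrite -subr_eq0; apply/eqP/rnorm0_eq0/eqP.
  rewrite eq_le rnorm_ge0 andbT (le_trans (below _))//.
  have -> : T (x - y) = 0.
    by rewrite addrC -scaleN1r analysis_linear Txy scaleN1r addNr.
  by rewrite rnorm0 mulr0.
exists S; split=> //; first by move=> x; apply: Tinj; rewrite ST.
by exists (Num.sqrt A)^-1 => a; rewrite -{2}(ST a).
Qed.

(** The vector [y] representing [c |-> <q c, x>] is the projection of [x] onto the closed span; it
    has the same products with every [h_i], so [T y = T x]. *)
Lemma analysis_injective_dense : injective T ->
  closure (lin_span h) = [set: H].
Proof.
move=> Tinj; rewrite -subTset => x _.
pose q c := \sum_(i \in [set: I]) c i *: h i.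
have [||u v w fv fw|u v w fv fw|c fc|y [qy yP]] := @riesz_representation _ _ _ _ ip_norm
    (I -> K) (@finitely_supported R k I) q (fun c => ip (q c) x) (rnorm x).
- by apply/finitely_supportedP; exists fset0.
- exact: finitely_supported_comb.
- exact: fsum_comb.
- by rewrite /q fsum_comb// ipDl ipZl.
- by rewrite mulrC; exact: rnorm_ip.
have -> : x = y.
  apply: Tinj; apply: val_inj; apply/funext => i; rewrite !TE !(ipC _ _ (h i)).
  have := yP _ (finitely_supported_delta R k i).
  by rewrite /q fsum_delta => ->.
by apply: closure_subset qy => _ [c fc <-]; exists c.
Qed.

Lemma invertible_riesz_basis : invertible_op T -> riesz_basis h.
Proof.
move=> [_ [M TM] [S [TK SK [N SN]]]]; split.
  by apply: analysis_injective_dense; exact: can_inj TK.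
(* Raising both constants to at least 1 makes them positive and gives [N1 ^- 2 <= 1 <= M1 ^+ 2]. *)
pose M1 := Num.max M 1; pose N1 := Num.max N 1.
have M1_gt0 : 0 < M1 by rewrite lt_max ltr01 orbT.
have N1_gt0 : 0 < N1 by rewrite lt_max ltr01 orbT.
exists (N1 ^- 2), (M1 ^+ 2); split.
- by rewrite invr_gt0 exprn_gt0.
- apply: (@le_trans _ _ 1).
    by rewrite invf_le1 ?exprn_gt0// exprn_ege1// le_max lexx orbT.
  by rewrite exprn_ege1// le_max lexx orbT.
apply/riesz_boundsP => F c; set y := \sum_(i <- F) c i *: h i.
set s := \sum_(i <- F) _.
have s0 : 0 <= s by apply: sumr_ge0 => i _; exact: sqr_ge0.
(* After taking square roots the goals are [sqrt(s) <= |y| N1] and [|y| <= M1 sqrt(s)]. *)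
rewrite -{1 2}(sqr_sqrtr s0) mulrC ler_pdivrMr ?exprn_gt0// -!exprMn.
rewrite !ler_sqr ?nnegrE ?mulr_ge0 ?rnorm_ge0 ?sqrtr_ge0 ?(ltW M1_gt0) ?(ltW N1_gt0)//.
apply/andP; split.
(* Lower bound: the truncation [a] of [c] equals [T (S a)], so [s = <y, S a> <= |y| N1 sqrt(s)]. *)
- have [ac ac_le] := fset_restrict_sqnorm F c.
  pose a : ell2 R k I := Sub (fset_restrict F c) ac.
  have [->|sn0] := eqVneq (Num.sqrt s) 0; first by rewrite mulr_ge0 ?rnorm_ge0// ltW.
  have {}sn0 : 0 < Num.sqrt s by rewrite lt_neqAle eq_sym sn0 sqrtr_ge0.
  rewrite -(ler_pM2r sn0) -expr2 sqr_sqrtr//.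
  have sE : s = rnorm (ip y (S a)).
    rewrite ip_fsum SK -(rnorm_of_real k s0) -sum_mul_sconj; congr rnorm.
    by apply: eq_big_seq => i iF; rewrite /= /fset_restrict iF.
  rewrite {1}sE (le_trans (rnorm_ip ip_norm _ _))// -mulrA.
  rewrite ler_wpM2l ?rnorm_ge0//.
  apply: (@le_trans _ _ (N1 * rnorm a)).
    by rewrite (le_trans (SN a))// ler_wpM2r ?rnorm_ge0// le_max lexx.
  rewrite (ler_wpM2l (ltW N1_gt0))//.
  by have -> : rnorm a = sqnorm (fset_restrict F c) by exact: re_of_real.
(* Upper bound: [|y|^2 = <y, y> <= sqrt(s) |T y| <= sqrt(s) M1 |y|]. *)
- have [->|y0] := eqVneq (rnorm y) 0.
    by rewrite mulr_ge0 ?sqrtr_ge0// ltW.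
  have {}y0 : 0 < rnorm y by rewrite lt_neqAle eq_sym y0 rnorm_ge0.
  rewrite -(ler_pM2r y0) -expr2.
  have -> : rnorm y ^+ 2 = rnorm (ip y y).
    by rewrite ip_rnorm// rnorm_of_real ?sqr_ge0.
  rewrite (le_trans (rnorm_ip_fsum_le _ _ _))// -/s (mulrC M1) -mulrA.
  rewrite ler_wpM2l ?sqrtr_ge0// (le_trans (TM y))// ler_wpM2r ?rnorm_ge0//.
  by rewrite le_max lexx.
Qed.

End AnalysisRieszBasis.

Theorem proposition2p12 (R : realType) (k : scalar_kind)
    (H : completeNormedModType (scalarField R k)) (ip : {dot H for @sconj R k})
    (ip_norm : forall x : H, ip x x = `|x| ^+ 2)
    (H_separable : separable H)
    (I : countType) (f g : I -> H)
    (f_bessel : bessel ip f) (g_bessel : bessel ip g)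
    (L1 L2 : {linear H -> H})
    (L1_bounded : bounded_op L1) (L2_bounded : bounded_op L2) :
  riesz_basis (fun i => L1 (f i) + L2 (g i)) <->
  invertible_op (fun x : H =>
    analysis f_bessel (adjoint ip L1 x) + analysis g_bessel (adjoint ip L2 x)).
Proof.
set h := fun i => _; set T := fun x : H => _.
(* Moving [L1] and [L2] across the inner product identifies [T] as the analysis operator of [h]. *)
have TE x i : val (T x) i = ip x (h i).
  rewrite /= fctE /= linearDr/= (ipC _ (adjoint ip L1 x)) (ipC _ (adjoint ip L2 x)).
  by rewrite -!ip_adjointE// -!ipC.
split; first exact: (riesz_basis_invertible ip_norm TE).
exact: (invertible_riesz_basis ip_norm TE).
Qed.
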